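(* Let $u$ be a nonprincipal ultrafilter on $\mathbb{Z}$. If $u$ is $(\mathbb{Z},3)$-Ramsey, then $u$ is selective.
   Context: For $n\geq 1$, a colouring $c:[\mathbb{Z}]^n\to 2$ (where $[\mathbb{Z}]^n$ is the set of $n$-element subsets of $\mathbb{Z}$ and $2=\{0,1\}$) is $\mathbb{Z}$-invariant if $c(\{x_1,\ldots,x_n\})=c(\{x_1+z,\ldots,x_n+z\})$ for all $\{x_1,\ldots,x_n\}\in[\mathbb{Z}]^n$ and all $z\in\mathbb{Z}$. An ultrafilter $u$ on $\mathbb{Z}$ is $(\mathbb{Z},n)$-Ramsey if for every $\mathbb{Z}$-invariant colouring $c:[\mathbb{Z}]^n\to 2$ there is $A\in u$ such that $c$ is constant on $[A]^n$. A nonprincipal ultrafilter $u$ on a countable set $S$ is selective (equivalently, Ramsey) if for every partition of $S$, either some piece of the partition belongs to $u$ or there is $A\in u$ meeting each piece in at most one point. *)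

(* Defs.v *)
From mathcomp Require Import all_boot all_order all_algebra finmap.
From mathcomp Require Import all_classical.

Set Implicit Arguments.
Unset Strict Implicit.
Unset Printing Implicit Defensive.

Import GRing.Theory.

Local Open Scope fset_scope.
Local Open Scope classical_set_scope.
Local Open Scope ring_scope.

(* [T]^n *)
Definition nsubset (T : choiceType) (n : nat) : Type :=
  {s : {fset T} | #|` s| == n}.

(* Translation is expressed through the equation [val t = s + z], which avoids
   transporting the cardinality proof along s |-> s + z. *)
Definition Zinvariant (n : nat) (c : nsubset int n -> bool) : Prop :=
  forall (s t : nsubset int n) (z : int),
    val t = [fset x + z | x in val s] -> c s = c t.

Definition constant_on (T : choiceType) (n : nat) (c : nsubset T n -> bool)
    (A : set T) : Prop :=
  forall s t : nsubset T n,
    [set` val s] `<=` A -> [set` val t] `<=` A -> c s = c t.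

Definition ZRamsey (n : nat) (u : set_system int) : Prop :=
  UltraFilter u /\
  forall c : nsubset int n -> bool, Zinvariant c ->
    exists2 A : set int, u A & constant_on c A.

Definition nonprincipal (T : Type) (u : set_system T) : Prop :=
  forall x : T, u <> principal_filter x.

(* A partition is given as the set P of its pieces, indexed by themselves. *)
Definition selective (T : countType) (u : set_system T) : Prop :=
  [/\ UltraFilter u, nonprincipal u &
      forall P : set (set T), partition P id [set: T] ->
        (exists2 B : set T, P B & u B) \/
        (exists2 A : set T, u A & forall B, P B -> is_subset1 (A `&` B))].

(* Main.v *)
(** A translation invariant colouring of the triples [x < y < z] is a colouring
    of the pairs of gaps [(y - x, z - y)].  Assume that [u] contains every tail
    of [int] (otherwise reflect it).  Comparing the two gaps produces a set
    [A] in [u] each of whose gaps is larger than the distance to its left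
    end from a fixed [x0], so that [A] meets each of its nontrivial
    translates in a finite set.  Given the equivalence
    relation [E] of a partition, colour the pair of gaps [(a, b)] by whether
    some [p <= 2a] satisfies [p \in A], [p + b \in A] and [E p (p + b)].  On a
    homogeneous set [B], the negative colour makes almost all points of [B]
    inequivalent (take [p = y]).  For the positive colour fix [x < y] in [B]:
    as [z] grows, [z] and [z + (p - y)] both lie in [A] while [p - y] remains
    bounded, which forces [p = y], so that [y] is equivalent to almost all
    [z]. *)

Require Import Defs.
From mathcomp Require Import all_boot all_order all_algebra finmap.
From mathcomp Require Import all_classical.
From mathcomp Require Import zify.

Set Implicit Arguments.
Unset Strict Implicit.
Unset Printing Implicit Defensive.

Import Order.TTheory GRing.Theory Num.Theory.

Local Open Scope classical_set_scope.
Local Open Scope ring_scope.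

Definition gap_Ramsey (u : set_system int) : Prop :=
  forall c : int -> int -> bool, exists b, exists2 A : set int, u A &
    forall x y z, A x -> A y -> A z -> x < y -> y < z -> c (y - x) (z - y) = b.

Definition contains_tails (u : set_system int) : Prop :=
  forall n : int, u [set x | n < x].

Lemma gap_Ramsey_sparse (u : set_system int) : ProperFilter u ->
  contains_tails u -> gap_Ramsey u ->
  exists x0, exists2 A : set int, u A &
    forall p q, A p -> A q -> p < q -> x0 < p /\ p - x0 < q - p.
Proof.
move=> uP tails /(_ (fun a b => a < b))[b [A uA hA]].
have [x Ax] := filter_ex uA.
have uA' : u (A `&` [set p | x < p]) by apply: filterI.
have [p [Ap /= xp]] := filter_ex uA'.
(* A point [q] this far out makes the second gap of [x], [p], [q] exceed the first, so the
   homogeneous colour is [true]. *)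
have [q [Aq /= pq]] := filter_ex (filterI uA (tails (p + (p - x)))).
have bT : b = true.
  by rewrite -(hA x p q) //; lia.
exists x, (A `&` [set p | x < p]) => // p' q' [Ap' /= xp'] [Aq' _] pq'.
by split=> //; rewrite hA.
Qed.

Lemma gap_Ramsey_dichotomy (u : set_system int) (E : int -> int -> Prop) :
  ProperFilter u -> contains_tails u -> gap_Ramsey u ->
  (exists y, u [set z | E y z]) \/
  (exists2 D : set int, u D & forall y z, D y -> D z -> y < z -> ~ E y z).
Proof.
move=> uP tails uR.
have [x [A uA sparse]] := gap_Ramsey_sparse uP tails uR.
have [b [B uB hB]] := uR (fun a b =>
  `[< exists p, [/\ A p, p <= a + a, A (p + b) & E p (p + b)] >]).
have uAB : u (A `&` B) by apply: filterI.
have [w [Aw Bw]] := filter_ex uAB.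
case: b hB => hB; [left | right].
- have [y [[Ay By] /= wy]] := filter_ex (filterI uAB (tails w)).
  exists y.
  (* The tail from [y + y - x] rules out [p < y]; the tail from [y - w - w + x] rules out [p > y],
     through [p <= 2(y - w)]. *)
  apply: filterS (filterI uAB (filterI (tails (y + y - x)) (filterI (tails y)
    (tails (y - w - w + x))))) => z [[Az Bz]] /= [z1 [z2 z3]].
  have /asboolP[p [Ap ple Apz Epz]] := hB w y z Bw By Bz wy z2.
  suff py : p = y by move: Epz; rewrite py addrC subrK.
  have [py|yp|//] := ltgtP p y.
  + have xp : x < p by have [//|] := sparse p y Ap Ay.
    have [|_] := sparse _ _ Apz Az; lia.
  + have [|_] := sparse _ _ Az Apz; lia.
(* The bound [w + w < y] makes [p = y] admissible in the colouring with [a = y - w]. *)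
- exists ((A `&` B) `&` ([set y | w + w < y] `&` [set y | w < y])).
    by apply: filterI => //; apply: filterI.
  move=> y z [[Ay By] [/= wwy wy]] [[Az Bz] _] yz Eyz.
  have /asboolP[] := hB w y z Bw By Bz wy yz.
  by exists y; rewrite (addrC y (z - y)) subrK; split=> //; lia.
Qed.

(** Colour a triple by the two gaps of its sorted list: translation commutes with sorting and
    preserves gaps. *)
Lemma ZRamsey_gap_Ramsey (u : set_system int) : ZRamsey 3 u -> gap_Ramsey u.
Proof.
move=> [uU uR] c.
pose d (s : nsubset int 3) :=
  let l := sort <=%O (val s : seq int) in c (l`_1 - l`_0) (l`_2 - l`_1).
have d_inv : Zinvariant d.
  move=> s t z st; rewrite /d.
  have -> : sort <=%O (val t : seq int) =
            map (+%R^~ z) (sort <=%O (val s : seq int)).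
    rewrite -[RHS]sort_le_id; last first.
      rewrite sorted_map (eq_sorted (e' := <=%O)) ?sort_le_sorted //.
      by move=> a b /=; rewrite lerD2r.
    apply/perm_sort_leP/uniq_perm; rewrite ?map_inj_uniq ?sort_uniq ?fset_uniq //.
      exact: addIr.
    move=> a; rewrite st; apply/imfsetP/mapP => /= -[r rs ->]; exists r => //.
      by rewrite mem_sort.
    by rewrite mem_sort in rs.
  have sz : size (sort <=%O (val s : seq int)) = 3.
    by rewrite size_sort; apply/eqP/(valP s).
  by rewrite /= !(nth_map 0) ?sz //= !opprD !(addrACA _ z) !subrr !addr0.
have [A uA hA] := uR d d_inv.
have dE x y z : A x -> A y -> A z -> x < y -> y < z ->
    exists2 s : nsubset int 3, [set` val s] `<=` A & d s = c (y - x) (z - y).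
  move=> Ax Ay Az xy yz.
  have xyzE : perm_eq (enum_fset [fset x; y; z]%fset) [:: x; y; z].
    apply: uniq_perm => //=; first by rewrite !inE; lia.
    by move=> a; rewrite !inE orbA.
  have card3 : #|` [fset x; y; z]%fset| == 3 by rewrite (perm_size xyzE).
  exists (exist (fun s : {fset int} => #|` s|%fset == 3) _ card3) => /=.
    by move=> a /=; rewrite !inE => /orP[/orP[]|] /eqP->.
  rewrite /d /=.
  move/perm_sort_leP: xyzE => ->.
  by rewrite sort_le_id //= (ltW xy) (ltW yz).
(* Homogeneity only equates colours, so [b] is read off from whether some increasing triple of [A]
   has colour [true]. *)
have [gT|gT] := pselect (exists x y z,
  [/\ A x, A y, A z, x < y & y < z /\ c (y - x) (z - y)]).
- exists true, A => // x y z Ax Ay Az xy yz.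
  have [x' [y' [z' [Ax' Ay' Az' xy' [yz' <-]]]]] := gT.
  have [s sA <-] := dE x y z Ax Ay Az xy yz.
  have [t tA <-] := dE x' y' z' Ax' Ay' Az' xy' yz'.
  exact: hA.
- exists false, A => // x y z Ax Ay Az xy yz.
  by apply/negP => cT; apply: gT; exists x, y, z.
Qed.

Lemma nonprincipal_set1 (T : Type) (u : set_system T) (x : T) :
  UltraFilter u -> nonprincipal u -> u (~` [set x]).
Proof.
move=> uU uN.
have [ux|//] := in_ultra_setVsetC [set x] uU.
case: (uN x); rewrite predeqE => W; split=> [uW|/principal_filterP Wx].
  by apply/principal_filterP; have [y [Wy <-]] := filter_ex (filterI uW ux).
by apply: filterS ux => y ->.
Qed.

(** The ultrafilter contains a half-line, up to reflection the nonnegative one; removing the points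
    0, 1, 2, ... one at a time then gives every tail. *)
Lemma ultra_tails (u : set_system int) : UltraFilter u -> nonprincipal u ->
  contains_tails u \/ contains_tails (-%R @ u).
Proof.
move=> uU uN.
have tailsP (v : set_system int) : Filter v -> (forall x, v (~` [set x])) ->
    v [set x | 0 <= x] -> contains_tails v.
  move=> vF vN v0 n.
  suff vn (m : nat) : v [set x | m%:Z <= x].
    by apply: filterS (vn `|n|.+1%N) => x /=; lia.
  elim: m => // m IH.
  apply: filterS (filterI IH (vN m%:Z)) => x /= [mx /= xm].
  have : x <> m by [].
  lia.
have uN' x := nonprincipal_set1 x uU uN.
have [u0|u0] := in_ultra_setVsetC [set x : int | 0 <= x] uU; [left|right].
  exact: tailsP.
apply: tailsP.
- move=> x; apply: (@filterS _ u _ _ _ _ (uN' (- x))) => y /= yx xy.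
  by apply: yx; rewrite -xy opprK.
- by apply: (@filterS _ u _ _ _ _ u0) => y /=; lia.
Qed.

(** Reflection reverses a triple and so exchanges its two gaps. *)
Lemma gap_Ramsey_opp (u : set_system int) : gap_Ramsey u -> gap_Ramsey (-%R @ u).
Proof.
move=> uR c; have [b [A uA hA]] := uR (fun a a' => c a' a).
exists b, (-%R @^-1` A).
  rewrite /fmap /= -comp_preimage; apply: (eq_ind _ u uA).
  by apply/seteqP; split=> x /=; rewrite opprK.
move=> x y z /= Ax Ay Az xy yz.
rewrite -(hA (- z) (- y) (- x)) //; try lia.
by congr c; lia.
Qed.

Lemma selective_of_dichotomy (T : countType) (u : set_system T) :
  UltraFilter u -> nonprincipal u ->
  (forall E : T -> T -> Prop, (forall x y, E x y -> E y x) ->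
    (exists y, u [set z | E y z]) \/
    (exists2 D : set T, u D & forall y z, D y -> D z -> y <> z -> ~ E y z)) ->
  selective u.
Proof.
move=> uU uN uE; split=> // P [_ Pdisj _].
pose E x y := exists B, [/\ P B, B x & B y].
have [|[y uy]|[D uD hD]] := uE E.
- by move=> x y [B [PB Bx By]]; exists B.
- left; have [z [B [PB By _]]] := filter_ex uy.
  exists B => //; apply: filterS uy => z' [B' [PB' By' Bz']].
  by rewrite (Pdisj B B' PB PB') //; exists y.
- right; exists D => // B PB y z [Dy By] [Dz Bz].
  apply: contrapT => yz; apply: hD yz _ => //.
  by exists B.
Qed.

Theorem theorem5p1 (u : set_system int) (u_ultra : UltraFilter u)
    (u_nonprincipal : nonprincipal u) :
  ZRamsey 3 u -> selective u.
Proof.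
move=> /ZRamsey_gap_Ramsey uR.
apply: selective_of_dichotomy => // E Esym.
have [tails|tails] := ultra_tails u_ultra u_nonprincipal.
- have [|[D uD hD]] := gap_Ramsey_dichotomy E _ tails uR; [by left|right].
  exists D => // y z Dy Dz yz Eyz.
  have [lt_yz|lt_zy|//] := ltgtP y z; first exact: hD lt_yz Eyz.
  exact: hD lt_zy (Esym _ _ Eyz).
- have [[y uy]|[D uD hD]] := gap_Ramsey_dichotomy (fun y z => E (- y) (- z)) _
    tails (gap_Ramsey_opp uR); [left|right].
    by exists (- y); apply: (@filterS _ u _ _ _ _ uy) => z /=; rewrite opprK.
  exists (-%R @^-1` D) => // y z /= Dy Dz yz Eyz.
  have [lt_yz|lt_zy|//] := ltgtP y z.
    (* Negation reverses the order of [y] and [z]; symmetry of [E] compensates. *)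
    by apply: (hD (- z) (- y)); rewrite ?ltrN2 ?opprK //; apply: Esym.
  by apply: (hD (- y) (- z)); rewrite ?ltrN2 ?opprK.
Qed.
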